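(* Let $\mathcal{J}$ be a tall translation invariant ideal on $\omega$ (for instance, $\mathcal{Z}$ or the summable ideal $\mathcal{I}_{1/n}:=\{A\subseteq\omega:\sum_{n\in A}\frac{1}{n+1}<\infty\}$). Then $\mathsf{H}_{\boldsymbol{b}}(\mathcal{J})\notin\mathscr{H}(\mathrm{Fin})$, where $\boldsymbol{b}=(2^n:n\in\omega)$.
   Context: $\omega=\{0,1,2,\dots\}$; $\mathbb{T}=\mathbb{R}/\mathbb{Z}$; $\|x\|:=\min\{|x-z|:z\in\mathbb{Z}\}$. $\mathrm{Fin}$ is the ideal of finite subsets of $\omega$; $\mathcal{Z}$ is the ideal of subsets of $\omega$ of asymptotic density zero. An ideal on $\omega$ is a family $\mathcal{I}\subseteq\mathcal{P}(\omega)$ closed under subsets and finite unions, with $\mathrm{Fin}\subseteq\mathcal{I}$ and $\omega\notin\mathcal{I}$. An ideal is tall if every infinite subset of $\omega$ contains an infinite subset belonging to the ideal. An ideal $\mathcal{J}$ is translation invariant if for all $A\in\mathcal{J}$ and $n\in\omega$ we have $A-n:=\{k\in\omega:k+n\in A\}\in\mathcal{J}$. For $\boldsymbol{a}=(a_n:n\in\omega)\in\mathbb{Z}^\omega$, $\mathsf{H}_{\boldsymbol{a}}(\mathcal{I}):=\{x\in\mathbb{T}:\{n\in\omega:\|a_nx\|\ge\varepsilon\}\in\mathcal{I}\text{ for all }\varepsilon>0\}$, and $\mathscr{H}(\mathcal{I}):=\{\mathsf{H}_{\boldsymbol{a}}(\mathcal{I}):\boldsymbol{a}\in\mathbb{Z}^\omega\}$.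 *)

(* Defs.v *)
From HB Require Import structures.
From mathcomp Require Import all_boot all_order all_algebra.
From mathcomp Require Import generic_quotient ring_quotient.
From mathcomp Require Import all_classical all_reals all_analysis.

Set Implicit Arguments.
Unset Strict Implicit.
Unset Printing Implicit Defensive.

Import Order.TTheory GRing.Theory Num.Theory.
Import numFieldNormedType.Exports.

Local Open Scope classical_set_scope.
Local Open Scope ring_scope.
Local Open Scope quotient_scope.

Definition ideal (I : set (set nat)) : Prop :=
  [/\ forall A B : set nat, A `<=` B -> I B -> I A,
      forall A B : set nat, I A -> I B -> I (A `|` B),
      forall A : set nat, finite_set A -> I A
    & ~ I [set: nat] ].

Definition tall (I : set (set nat)) : Prop :=
  forall A : set nat, infinite_set A ->
    exists B : set nat, [/\ B `<=` A, infinite_set B & I B].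

Definition translation_invariant (J : set (set nat)) : Prop :=
  forall (A : set nat) (n : nat), J A -> J [set k | A (k + n)%N].

Definition Fin : set (set nat) := [set A | finite_set A].

(* The value of the ratio at n = 0 is 0 / 0 = 0 and does not affect the limit. *)
Definition Zdens (R : realType) : set (set nat) :=
  [set A : set nat | (#|[set i : 'I_n | `[< A i >]]%SET|%:R / n%:R : R) @[n --> \oo]
             --> (0 : R)].

Definition summable_ideal (R : realType) : set (set nat) :=
  [set A | (\esum_(n in A) (n.+1%:R^-1 : R)%:E < +oo)%E].

Definition integers (R : realType) : {pred R} := Num.int.
Arguments integers : clear implicits.

HB.instance Definition _ (R : realType) :=
  GRing.ZmodClosed.copy (integers R) (@Num.int_num_subdef R).

Definition torus (R : realType) := {ideal_quot integers R}.

HB.instance Definition _ (R : realType) := ZmodQuotient.on (torus R).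

(* The infimum is a minimum: see [distZ_min]. *)
Definition distZ (R : realType) (x : R) : R :=
  inf [set `|x - z%:~R| | z in [set: int]].

(* Independent of the representative: see [tnorm_pi]. *)
Definition tnorm (R : realType) (x : torus R) : R := distZ (repr x).

Definition Hset (R : realType) (a : nat -> int) (I : set (set nat)) :
    set (torus R) :=
  [set x | forall e : R, 0 < e -> I [set n | e <= tnorm (x *~ a n)]].

Definition scrH (R : realType) (I : set (set nat)) : set (set (torus R)) :=
  [set Hset a I | a in [set: nat -> int]].

Lemma distZ_min (R : realType) (x : R) :
  (exists z : int, distZ x = `|x - z%:~R|) /\
  (forall z : int, distZ x <= `|x - z%:~R|).
Proof.
have lb : has_lbound [set `|x - z%:~R| | z in [set: int]].
  by exists 0 => _ [z _ <-].
have le z : distZ x <= `|x - z%:~R| by apply: ge_inf => //; exists z.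
split=> //; pose f := Num.floor x.
have h1 : f%:~R <= x := Num.Theory.floor_le x.
have h2 : x < (f + 1)%:~R := Num.Theory.floorD1_gt x.
have e1 : `|x - f%:~R| = x - f%:~R by rewrite ger0_norm // subr_ge0.
have e2 : `|x - (f + 1)%:~R| = (f + 1)%:~R - x.
  by rewrite ler0_norm ?opprB // subr_le0 ltW.
have key z : `|x - f%:~R| <= `|x - z%:~R| \/ `|x - (f + 1)%:~R| <= `|x - z%:~R|.
  have [zf|] := leP z f.
    left; rewrite e1 (le_trans _ (ler_norm _)) // lerD2l lerN2.
    by rewrite ler_int.
  rewrite -lezD1 => fz; right; rewrite e2 distrC (le_trans _ (ler_norm _)) //.
  by rewrite lerD2r ler_int.
have [c|c] := leP `|x - f%:~R| `|x - (f + 1)%:~R|.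
  exists f; apply/eqP; rewrite eq_le le /=; apply: lb_le_inf.
    by exists `|x - f%:~R|; exists f.
  by move=> _ [z _ <-]; have [//|] := key z; apply: le_trans.
exists (f + 1); apply/eqP; rewrite eq_le le /=; apply: lb_le_inf.
  by exists `|x - f%:~R|; exists f.
by move=> _ [z _ <-]; have [|//] := key z; apply/le_trans/ltW.
Qed.

Lemma distZ_shift (R : realType) (x : R) (k : int) : distZ (x + k%:~R) = distZ x.
Proof.
rewrite /distZ; congr inf; apply/seteqP; split=> _ [z _ <-].
  by exists (z - k) => //; rewrite intrB opprB addrA.
by exists (z + k) => //; rewrite intrD opprD addrACA subrr addr0.
Qed.

Lemma tnorm_pi (R : realType) (x : R) : tnorm (\pi_(torus R) x) = distZ x.
Proof.
have : x == repr (\pi_(torus R) x) %[mod torus R] by rewrite reprK.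
rewrite -Quotient.idealrBE => /intrP[k xk].
by rewrite /tnorm -[in RHS](subrK (repr (\pi_(torus R) x)) x) xk addrC distZ_shift.
Qed.

(* Main.v *)
Require Import Defs.
From mathcomp Require Import all_boot all_order all_algebra.
From mathcomp Require Import generic_quotient ring_quotient.
From mathcomp Require Import all_classical all_reals all_analysis.
From mathcomp Require Import finmap zify ring lra.

Set Implicit Arguments.
Unset Strict Implicit.
Unset Printing Implicit Defensive.

Import Order.TTheory GRing.Theory Num.Theory.

Local Open Scope classical_set_scope.
Local Open Scope ring_scope.
Local Open Scope quotient_scope.

(** The set [H_b(J)] for [b_n = 2^n] is shown to differ from every set
[H_a(Fin) = {x : a_n x --> 0}].  It contains
- all dyadic rationals, since [2^n x = 0] from some [n] on;
- every [x = \sum_(k in S) 2^-(k+1)] with [S] in [J] ([Hset_binary_real]): if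
  [2^n x] is not close to an integer, then [S] has an element in a short window
  starting at [n], so [n] lies in one of finitely many translates of [S];
but not [1/3], because [2^n / 3] stays at distance [1/3] from the integers.

Suppose [H_b(J) = H_a(Fin)].  The dyadic rationals force every [2^m] to divide
all but finitely many [a_n], and [1/3] forces infinitely many [a_n] to be
nonzero; hence the set [V] of the 2-adic valuations of the nonzero [a_n] is
infinite.  Tallness puts an infinite subset of [V] in [J], and this subset
contains an infinite [S] as sparse as desired.  For [k] in [S], choose [n_k]
with [a_(n_k) = c 2^k], [c] odd, and let [x] have the binary digits [S].  Modulo
integers, [c 2^k x] is [1/2] (from the digit [k]) plus [c] times the tail of the
expansion after [k], and the next element of [S] is so far away that this
second term is at most [1/4] ([distZ_binary_real]).  So [a_(n_k) x] stays
[1/4] away from the integers for infinitely many [n_k], although [x] belongs to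
[H_b(J)].

For the two examples, a set is in the summable ideal iff its partial harmonic
sums are bounded, and in [Zdens] iff its counting function is eventually below
[e n] for each [e > 0].  Summable sets have density zero
([summable_sub_Zdens]); hence tallness and the membership of finite sets need a
proof only for the summable ideal, and properness only for [Zdens]. *)

(** * Infinite sets of natural numbers and sparse subsets *)

Lemma infinite_natP (A : set nat) :
  infinite_set A <-> forall N, exists2 j, A j & (N < j)%N.
Proof.
split=> [infA N|unb finA].
  apply/not_exists2P => bdd; apply/infA/(sub_finite_set _ (finite_II N.+1)).
  by move=> j Aj /=; rewrite ltnS leqNgt; apply/negP => Nj; case: (bdd j).
have [X AX] := finite_fsetP.1 finA.
have [j Aj] := unb (\max_(x <- X) x)%N; rewrite ltnNge => /negP; apply.
have jX : j \in X by move: Aj; rewrite AX.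
exact: (@leq_bigmax_seq _ _ xpredT (fun x => x) _ jX).
Qed.

(** The gap function [g] may depend on the left element, which lets the
expansions built from [S] outrun coefficients read off along [S] itself. *)
Lemma sparse_subset (A : set nat) (g : nat -> nat) : infinite_set A ->
  exists S : set nat, [/\ S `<=` A, infinite_set S &
    forall j k, S j -> S k -> (j < k)%N -> (g j < k)%N].
Proof.
move=> /infinite_natP unbA.
have /choice[h hA] N : exists j, A j /\ (N < j)%N by have [j] := unbA N; exists j.
pose b i := iter i (fun k => h (maxn k (g k))) (h 0%N).
have bS i : (b i < b i.+1)%N /\ (g (b i) < b i.+1)%N.
  by have [_] := hA (maxn (b i) (g (b i))); rewrite gtn_max => /andP.
have b_lt : {homo b : i j / (i < j)%N}.
  by apply: homo_ltn => [|i]; [exact: ltn_trans|case: (bS i)].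
have b_le : {mono b : i j / (i <= j)%N} by apply: leq_mono.
exists (range b); split.
- by move=> _ [[|i] _ <-]; apply: (hA _).1.
- apply/infinite_natP => N; exists (b N.+1); first by exists N.+1.
  by elim: N => [|N IH]; [case: (bS 0%N)|apply: leq_ltn_trans IH (bS _).1]; lia.
- move=> _ _ [i _ <-] [j _ <-]; rewrite (leqW_mono b_le) => ij.
  by apply: leq_trans (bS i).2 _; rewrite b_le.
Qed.

(** * Real numbers with prescribed binary digits *)

(** The integer whose binary digits, most significant first, are the first [n]
values of the indicator of [S]; it is the integer part of [2^n x] for
[x = \sum_(k in S) 2^-(k+1)], up to the ambiguity of dyadic rationals. *)
Fixpoint binary (S : set nat) (n : nat) : nat :=
  if n is k.+1 then ((binary S k).*2 + `[< S k >])%N else 0%N.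

Lemma binary_bounds (S : set nat) (n m : nat) :
  (2 ^ m * binary S n <= binary S (n + m) < 2 ^ m * (binary S n).+1)%N.
Proof.
elim: m => [|m /andP[lo hi]]; first by rewrite addn0 !mul1n leqnn ltnSn.
by rewrite addnS /= expnS; case: `[< _ >]; apply/andP; split; lia.
Qed.

Lemma binary_gap (S : set nat) (n m : nat) :
  (forall k, (n <= k < n + m)%N -> ~ S k) ->
  binary S (n + m) = (2 ^ m * binary S n)%N.
Proof.
elim: m => [_|m IH gap]; first by rewrite addn0 mul1n.
rewrite addnS /= IH => [|k /andP[nk kn]]; last by apply: gap; lia.
by rewrite asboolF ?expnS; [lia|apply: gap; lia].
Qed.

(** The bounds are non-strict on both sides so that they hold even when [S] is
cofinite.  The intervals [[binary S n / 2^n, (binary S n + 1) / 2^n]] are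
nested, and [x] is the supremum of their left ends. *)
Lemma binary_real (R : realType) (S : set nat) : exists x : R,
  forall n, (binary S n)%:R <= 2 ^+ n * x <= (binary S n)%:R + 1.
Proof.
have p2 n : 0 < 2 ^+ n :> R by rewrite exprn_gt0.
pose E := [set (binary S n)%:R / (2 ^+ n : R) | n in [set: nat]].
have ubE n : ubound E (((binary S n)%:R + 1) / 2 ^+ n).
  move=> _ [m _ <-]; rewrite ler_pdivrMr // mulrAC ler_pdivlMr //.
  rewrite natr1 -!(natrX R 2) -!natrM ler_nat.
  have [nm|/ltnW mn] := leqP n m.
    have /andP[_ /ltnW] := binary_bounds S n (m - n); rewrite subnKC // => hi.
    apply: leq_trans (leq_mul hi (leqnn _)) _.
    by rewrite -[in leqRHS](subnKC nm) expnD; lia.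
  have /andP[lo _] := binary_bounds S m (n - m); rewrite subnKC // in lo.
  rewrite -[in leqLHS](subnKC mn) expnD.
  by apply: leq_trans (_ : _ <= 2 ^ m * binary S n)%N _; nia.
have supE : has_sup E.
  split; first by exists ((binary S 0)%:R / 2 ^+ 0); exists 0%N.
  by exists (((binary S 0)%:R + 1) / 2 ^+ 0); apply: ubE.
exists (sup E) => n; rewrite ![2 ^+ n * _]mulrC; apply/andP; split.
  by rewrite -ler_pdivrMr //; apply: sup_upper_bound => //; exists n.
by rewrite -ler_pdivlMr //; apply: ge_sup => //; exact: supE.1.
Qed.

(** A block of [m] zero digits makes [2^n x] close to an integer. *)
Lemma binary_real_gap (R : realType) (S : set nat) (x : R) (n m : nat) :
  (forall n, (binary S n)%:R <= 2 ^+ n * x <= (binary S n)%:R + 1) ->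
  (forall k, (n <= k < n + m)%N -> ~ S k) ->
  0 <= 2 ^+ n * x - (binary S n)%:R <= (2 ^+ m)^-1.
Proof.
move=> xP gap; have p2 : 0 < 2 ^+ m :> R by rewrite exprn_gt0.
have /andP[lo _] := xP n; have /andP[_ hi] := xP (n + m)%N.
rewrite binary_gap // natrM natrX exprD in hi.
rewrite subr_ge0 lo /= -[leRHS]mul1r ler_pdivlMr //; nra.
Qed.

(** * Membership in the sets [H_b(J)] and distance to the integers *)

Lemma tnorm_piMz (R : realType) (x : R) (a : int) :
  tnorm ((\pi_(torus R) x) *~ a) = distZ (a%:~R * x).
Proof. by rewrite -[_ *~ a]raddfMz tnorm_pi -mulrzl. Qed.

Lemma distZ_ge0 (R : realType) (x : R) : 0 <= distZ x.
Proof. by have [[z ->] _] := distZ_min x. Qed.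

Lemma distZ_int (R : realType) (a : int) : distZ (a%:~R : R) = 0.
Proof.
apply/eqP; rewrite eq_le distZ_ge0 andbT.
by apply: le_trans ((distZ_min _).2 a) _; rewrite subrr normr0.
Qed.

(** [a / d] and an integer differ by a nonzero multiple of [1 / d]. *)
Lemma distZ_frac_ge (R : realType) (a : int) (d : nat) : (0 < d)%N ->
  ~~ (d %| a)%Z -> d%:R^-1 <= distZ (a%:~R / d%:R : R).
Proof.
move=> d0 nda; have [[z ->] _] := distZ_min (a%:~R / d%:R : R).
have dR : 0 < d%:R :> R by rewrite ltr0n.
rewrite -[leLHS]mul1r ler_pdivrMr // -[X in _ * X](gtr0_norm dR) -normrM mulrBl.
rewrite divfK ?gt_eqF //.
have -> : a%:~R - z%:~R * d%:R = (a - z * d)%:~R :> R by rewrite intrB intrM.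
rewrite -intr_norm -[leLHS]/(1%:~R) ler_int -gtz0_ge1 normr_gt0 subr_eq0.
by apply: contraNneq nda => ->; rewrite dvdz_mull.
Qed.

(** This is where translation invariance enters: the set is the union of the
[m] translates [S - i]. *)
Lemma ideal_shifts (J : set (set nat)) (S : set nat) (m : nat) :
  ideal J -> translation_invariant J -> J S ->
  J [set k | exists2 i, (i < m)%N & S (k + i)%N].
Proof.
move=> [Jsub JU Jfin _] Jt JS; elim: m => [|m IH].
  by apply: Jsub (Jfin _ (@finite_set0 nat)) => k [].
apply: Jsub (JU _ _ IH (Jt S m JS)) => k [i]; rewrite ltnS leq_eqVlt.
by move=> /orP[/eqP ->|im] Si; [right|left; exists i].
Qed.

Lemma Hset_binary_real (R : realType) (J : set (set nat)) (S : set nat) (x : R) :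
  ideal J -> translation_invariant J -> J S ->
  (forall n, (binary S n)%:R <= 2 ^+ n * x <= (binary S n)%:R + 1) ->
  Hset (fun n => 2 ^+ n) J (\pi_(torus R) x).
Proof.
move=> idJ Jt JS xP e e0.
have [m me] : exists m, (2 ^+ m)^-1 < e.
  have e1 : 0 <= e^-1 by rewrite invr_ge0 ltW.
  exists (Num.truncn e^-1).+1; rewrite invf_plt ?posrE ?exprn_gt0 //.
  apply: lt_trans (truncnS_gt _) _.
  by rewrite -natrX ltr_nat ltn_expl.
have [Jsub _ _ _] := idJ; apply: Jsub (ideal_shifts m idJ Jt JS) => n /= ne.
apply: contrapT => gap; move: ne; apply/negP; rewrite -ltNge.
apply: le_lt_trans me; rewrite tnorm_piMz.
have /andP[lo hi] : 0 <= 2 ^+ n * x - (binary S n)%:R <= (2 ^+ m)^-1.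
  apply: binary_real_gap xP _ => k /andP[nk km] Sk; apply: gap.
  by exists (k - n)%N; rewrite ?subnKC //; lia.
apply: le_trans ((distZ_min _).2 (binary S n)%:Z) _.
by rewrite rmorphXn /= ger0_norm.
Qed.

Lemma Hset_dyadic (R : realType) (J : set (set nat)) (m : nat) : ideal J ->
  Hset (fun n => 2 ^+ n) J (\pi_(torus R) (2 ^ m)%N%:R^-1).
Proof.
move=> [Jsub _ Jfin _] e e0; apply: Jsub (Jfin _ (finite_II m)) => n /= ne.
rewrite ltnNge; apply/negP => mn; move: ne; apply/negP; rewrite -ltNge.
rewrite tnorm_piMz natrX rmorphXn /= -(subnK mn) exprD mulfK ?expf_neq0 //.
by rewrite -(rmorphXn (intmul 1)) distZ_int.
Qed.

(** Modulo integers, [c 2^k x = c / 2 + c d / 2] where [0 <= d <= 2^-(m+1)]: the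
odd [c] brings the first term to [1/2], and [`|c| <= 2^m] keeps the second
below [1/4]. *)
Lemma distZ_binary_real (R : realType) (S : set nat) (x : R) (k m : nat) (c : int) :
  (forall n, (binary S n)%:R <= 2 ^+ n * x <= (binary S n)%:R + 1) ->
  S k -> (forall j, (k < j <= k + m.+1)%N -> ~ S j) ->
  ~~ (2 %| c)%Z -> (`|c| <= 2 ^ m)%N ->
  4^-1 <= distZ ((c * 2 ^+ k)%:~R * x).
Proof.
move=> xP Sk gap oddc cm.
have := @binary_real_gap R S x k.+1 m.+1 xP.
rewrite /= asboolT // => /(_ _)/wrap[j /andP[kj jk]|]; first by apply: gap; lia.
set d := _ - _ => /andP[d0 dm].
have [[z ->] _] := distZ_min ((c * 2 ^+ k)%:~R * x).
(* [w / 2] is [c 2^k x - z] without the contribution of the digits after [k]. *)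
pose w : int := 2 * (c * (binary S k)%:Z - z) + c.
have w1 : 1 <= `|w%:~R : R|.
  rewrite -intr_norm -[leLHS]/(1%:~R) ler_int -gtz0_ge1 normr_gt0.
  apply: contraNneq oddc => w0.
  by have -> : c = 2 * (z - c * (binary S k)%:Z) by [lia]; rewrite dvdz_mulr.
have cd : `|c%:~R * d| <= 2^-1.
  rewrite normrM (ger0_norm d0).
  apply: le_trans (_ : 2 ^+ m * (2 ^+ m.+1)^-1 <= _); last first.
    by rewrite exprS invfM mulrCA divff ?mulr1 // expf_neq0.
  apply: ler_pM => //.
  by rewrite -intr_norm -abszE pmulrn -natrX ler_nat in cm *.
have -> : (c * 2 ^+ k)%:~R * x - z%:~R = (w%:~R + c%:~R * d) / 2.
  rewrite /w /d exprS -muln2 !(intrD, intrM, intrB, natrD, natrM) rmorphXn /=.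
  by field.
rewrite normrM (ger0_norm (_ : 0 <= 2^-1)) //.
have := lerB_normD (w%:~R) (c%:~R * d); lra.
Qed.
(** * Separation from the sets [H_a(Fin)] *)

(** The sequence [a] is tested on the points [2^-m], on [1/3], and on one point
with sparse binary digits at the valuations of the [a n]. *)
Lemma not_Hset_Fin (R : realType) (J : set (set nat)) :
  ideal J -> tall J -> translation_invariant J ->
  ~ scrH Fin (Hset (fun n => 2 ^+ n) J : set (torus R)).
Proof.
move=> idJ tallJ Jt [a _ aJ].
have [Jsub _ Jfin JT] := idJ.
have nondvd m : finite_set [set n | ~~ ((2 ^ m)%N %| a n)%Z].
  have := @Hset_dyadic R J m idJ; rewrite -aJ => /(_ (2 ^ m)%N%:R^-1).
  rewrite invr_gt0 ltr0n expn_gt0 => /(_ isT); apply: sub_finite_set => n /=.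
  by move=> ndv; rewrite tnorm_piMz distZ_frac_ge ?expn_gt0.
have nz : infinite_set [set n | a n != 0].
  move=> fin; apply: JT.
  have : Hset a Fin (\pi_(torus R) 3%:R^-1).
    move=> e e0; apply: sub_finite_set fin => n /=; apply: contraTneq => ->.
    by rewrite tnorm_piMz -ltNge mul0r (distZ_int R 0).
  rewrite aJ => /(_ 3%:R^-1); rewrite invr_gt0 ltr0n => /(_ isT).
  apply: Jsub => n _ /=; rewrite tnorm_piMz distZ_frac_ge //.
  by rewrite dvdzE abszX Euclid_dvdX.
pose v n := logn 2 `|a n|.
have infV : infinite_set [set k | exists2 n, a n != 0 & v n = k].
  apply/infinite_natP => N.
  have [n [an0 ndv]] := infinite_setN0 (infinite_setD nz (nondvd N.+1)).
  exists (v n); first by exists n.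
  by rewrite -pfactor_dvdn ?absz_gt0 //; move/negP: ndv; rewrite negbK dvdzE.
have [B [BV infB JB]] := tallJ _ infV.
have /choice[nu nuP] k : exists n, B k -> a n != 0 /\ v n = k.
  by have [/BV[n an0 <-]|nBk] := pselect (B k); [exists n|exists 0%N].
(* The odd part of [a (nu k)] is at most [2 ^ `|a (nu k)|], so
   [`|a (nu k)|.+1] zero digits after [k] suffice. *)
have [S [SB infS gap]] := sparse_subset (fun k => k + `|a (nu k)|.+1)%N infB.
have [x xP] := binary_real R S.
have JS : J S by apply: Jsub JB.
have := Hset_binary_real idJ Jt JS xP; rewrite -aJ => /(_ 4^-1).
rewrite invr_gt0 ltr0n => /(_ isT) finF.
(* [v] recovers [k] from [nu k], so finitely many bad indices would leave only
   finitely many [k] in [S]. *)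
apply: infS; apply: sub_finite_set (finite_image v finF) => k Sk /=.
have [ak0 vk] := nuP k (SB k Sk); exists (nu k) => //=.
have := pfactor_dvdnn 2 `|a (nu k)|; rewrite -/(v _) vk.
rewrite -[X in (X %| _)%N]/(`|(2 ^ k)%N%:Z|%N) -dvdzE => /dvdzP[c ac].
have ac' : `|a (nu k)|%N = (`|c| * 2 ^ k)%N by rewrite ac abszM.
rewrite tnorm_piMz ac -[(2 ^ k)%N%:Z]natz natrX.
apply: (distZ_binary_real (m := `|a (nu k)|) xP Sk).
- by move=> j /andP[kj jk] Sj; have := gap _ _ Sk Sj kj; lia.
- rewrite dvdzE; apply/negP => /dvdnP[q cq].
  have : (2 ^ k.+1 %| `|a (nu k)|)%N.
    by rewrite ac' cq -mulnA -expnS dvdn_mull.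
  by rewrite pfactor_dvdn ?absz_gt0 // -/(v _) vk ltnn.
- rewrite ac'; apply: leq_trans (ltnW (ltn_expl `|c| (isT : 1 < 2)%N)) _.
  by rewrite leq_pexp2l // leq_pmulr // expn_gt0.
Qed.

(** * The summable ideal and the density ideal *)

Definition count_below (A : set nat) (n : nat) : nat := (\sum_(k < n) `[< A k >])%N.

Definition harmonic_sum (R : realType) (A : set nat) (n : nat) : R :=
  \sum_(k < n) `[< A k >]%:R / k.+1%:R.

Lemma count_belowS A n : count_below A n.+1 = (count_below A n + `[< A n >])%N.
Proof. by rewrite /count_below big_ord_recr. Qed.

Lemma harmonic_sumS (R : realType) A n :
  harmonic_sum R A n.+1 = harmonic_sum R A n + `[< A n >]%:R / n.+1%:R.
Proof. by rewrite /harmonic_sum big_ord_recr. Qed.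

Lemma harmonic_sum_le (R : realType) A n m :
  (n <= m)%N -> harmonic_sum R A n <= harmonic_sum R A m.
Proof.
move: n m; apply: (@homo_leq _ (harmonic_sum R A) <=%R) => [//|? ? ?|n].
  exact: le_trans.
by rewrite harmonic_sumS lerDl divr_ge0.
Qed.

(** Multiplying out the quotient also removes the special case [n = 0]. *)
Lemma ZdensP (R : realType) (A : set nat) : Zdens R A <->
  forall e : R, 0 < e ->
    exists N, forall n, (N <= n)%N -> (count_below A n)%:R <= e * n%:R.
Proof.
have cardE n : #|[set i : 'I_n | `[< A i >]]%SET| = count_below A n.
  rewrite -sum1_card big_mkcond; apply: eq_bigr => i _.
  by rewrite inE; case: `[< _ >].
rewrite /Zdens /=; under eq_fun do rewrite cardE.
split=> [/cvgr0Pnorm_le/= lim e e0|small].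
  have [N _ NP] := lim e e0; exists N => n /NP /=.
  rewrite ger0_norm ?divr_ge0 //; case: n => [|n]; last by rewrite ler_pdivrMr.
  by move=> _; rewrite /count_below big_ord0 mulr0.
apply/cvgr0Pnorm_le => e e0; have [N NP] := small e e0; exists N => // n /NP /=.
rewrite ger0_norm ?divr_ge0 //; case: n => [|n]; last by rewrite ler_pdivrMr.
by move=> _; rewrite invr0 mulr0 ltW.
Qed.

Lemma summable_idealP (R : realType) (A : set nat) : summable_ideal R A <->
  exists M : R, forall n, harmonic_sum R A n <= M.
Proof.
pose f (k : nat) : \bar R := (k.+1%:R^-1)%:E.
have f0 k : (0 <= f k)%E by rewrite lee_fin invr_ge0.
have partial n :
    (\sum_(0 <= k < n | `[< A k >]) f k)%E = (harmonic_sum R A n)%:E.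
  rewrite /harmonic_sum big_mkord -sumEFin big_mkcond; apply: eq_bigr => k _.
  by case: `[< _ >]; rewrite ?mul1r ?mul0r.
rewrite /summable_ideal /= -/f.
have -> : A = [set k | `[< A k >]] by apply/seteqP; split=> k /asboolP.
rewrite -(@nneseries_esum _ f (fun k => `[< A k >])) //.
have -> : [set k | `[< A k >]] = A by apply/seteqP; split=> k /asboolP.
split=> [fin|[M AM]].
  exists (fine (\sum_(0 <= k <oo | `[< A k >]) f k)%E) => n.
  rewrite -lee_fin fineK; last first.
    by rewrite ge0_fin_numE //; apply: nneseries_ge0.
  by rewrite -partial; apply: nneseries_lim_ge.
apply: le_lt_trans (ltry M); apply: lime_le; first exact: is_cvg_nneseries.
by near=> n; rewrite partial lee_fin.
Unshelve. all: by end_near.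
Qed.

(** Choose [m] such that the harmonic sum of [A] beyond [m] is less than
[e / 2].  Each element of [A] in [[m, n)] contributes at least [1 / n] to it, so
there are at most [n e / 2] of them. *)
Lemma summable_sub_Zdens (R : realType) : summable_ideal R `<=` Zdens R.
Proof.
move=> A /summable_idealP[M AM]; apply/ZdensP => e e0.
have supE : has_sup (range (harmonic_sum R A)).
  by split; [exists (harmonic_sum R A 0), 0%N|exists M => _ [n _ <-]].
have e2 : 0 < e / 2 by rewrite divr_gt0.
have [_ [m _ <-] mP] := sup_adherent e2 supE.
have tail n : harmonic_sum R A n - harmonic_sum R A m <= e / 2.
  have := sup_upper_bound supE (_ : range _ (harmonic_sum R A n)).
  by move=> /(_ (ex_intro2 _ _ n I erefl)); lra.
have count n : (m <= n)%N -> (count_below A n)%:R <=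
    m%:R + n%:R * (harmonic_sum R A n - harmonic_sum R A m).
  elim: n => [|n IH].
    rewrite leqn0 => /eqP->.
    by rewrite /count_below big_ord0 mul0r addr0.
  rewrite leq_eqVlt => /orP[/eqP->|].
    rewrite subrr mulr0 addr0 ler_nat /count_below.
    by rewrite -[leqRHS]card_ord -sum1_card; apply: leq_sum => k _; case: `[< _ >].
  rewrite ltnS => mn; have {}IH := IH mn.
  have mnR := harmonic_sum_le R A mn.
  rewrite count_belowS harmonic_sumS natrD.
  set b := `[< _ >]%:R; set s := harmonic_sum R A n in IH mnR *.
  set t := harmonic_sum R A m in IH mnR *.
  have -> : n.+1%:R * (s + b / n.+1%:R - t) = n%:R * (s - t) + (s - t) + b.
    by rewrite -natr1; field; rewrite natr1.
  lra.
exists (maxn m (Num.truncn (m%:R / (e / 2))).+1) => n; rewrite geq_max => /andP[mn Nn].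
apply: le_trans (count n mn) _.
have mle : m%:R <= e / 2 * n%:R.
  rewrite mulrC -ler_pdivrMr //; apply/ltW/(lt_le_trans (truncnS_gt _)).
  by rewrite ler_nat.
have := ler_wpM2l (ler0n R n) (tail n); lra.
Qed.

(** [1 / (k + 1) <= (m + 1) / (k + m + 1)] compares the terms of [A - m] with those
of [A]. *)
Lemma translation_invariant_summable (R : realType) :
  translation_invariant (summable_ideal R).
Proof.
move=> A m /summable_idealP[M AM]; apply/summable_idealP.
exists (m.+1%:R * M) => n; apply: le_trans (ler_wpM2l (ler0n R m.+1) (AM (n + m)%N)).
elim: n => [|n IH].
  have := harmonic_sum_le R A (leq0n (0 + m)).
  by rewrite /harmonic_sum !big_ord0; apply: mulr_ge0.
rewrite addSn !harmonic_sumS mulrDr lerD //= mulrCA ler_wpM2l //.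
rewrite -[leLHS]mul1r ler_pdivlMr // mulrAC ler_pdivrMr // mul1r.
by rewrite -natrM ler_nat; nia.
Qed.

(** Shifting by [m] changes the counting function by at most [m]. *)
Lemma translation_invariant_Zdens (R : realType) : translation_invariant (Zdens R).
Proof.
move=> A m /ZdensP AZ; apply/ZdensP => e e0.
have e2 : 0 < e / 2 by rewrite divr_gt0.
have [N NP] := AZ _ e2.
exists (maxn N (Num.truncn (m%:R / (e / 2))).+1) => n; rewrite geq_max => /andP[Nn mn].
have mle : m%:R <= e / 2 * n%:R.
  rewrite mulrC -ler_pdivrMr //; apply/ltW/(lt_le_trans (truncnS_gt _)).
  by rewrite ler_nat.
have shift : (count_below [set k | A (k + m)%N] n <= count_below A (n + m))%N.
  elim: (n) => [|p IH]; first by rewrite /count_below big_ord0.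
  by rewrite addSn !count_belowS leq_add.
have window : (count_below A (n + m) <= count_below A n + m)%N.
  elim: (m) => [|p IH]; first by rewrite !addn0.
  by rewrite !addnS count_belowS; case: `[< _ >]; lia.
have : (count_below [set k | A (k + m)%N] n)%:R <= (count_below A n)%:R + m%:R :> R.
  by rewrite -natrD ler_nat (leq_trans shift).
have := NP n Nn; lra.
Qed.

Lemma asbool_setU (A B : set nat) k : (`[< (A `|` B) k >] <= `[< A k >] + `[< B k >])%N.
Proof.
by case: asboolP => [[/asboolT ->|/asboolT ->]|_] //; rewrite ?leq_addl ?leq_addr.
Qed.

Lemma asbool_sub (A B : set nat) k : A `<=` B -> (`[< A k >] <= `[< B k >])%N.
Proof. by move=> AB; case: asboolP => [/AB/asboolT ->|_]. Qed.

Lemma ideal_summable_Zdens (R : realType) :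
  ideal (summable_ideal R) /\ ideal (Zdens R).
Proof.
have finS (A : set nat) : finite_set A -> summable_ideal R A.
  move=> finA; have [N AN] : exists N, forall k, A k -> (k < N)%N.
    apply: contrapT => unb; apply: (infinite_natP A).2 finA => N.
    apply: contrapT => nj; apply: unb; exists N.+1 => k Ak; rewrite ltnS leqNgt.
    by apply/negP => Nk; apply: nj; exists k.
  apply/summable_idealP; exists (harmonic_sum R A N) => n.
  have [/harmonic_sum_le -> //|/ltnW Nn] := leqP n N.
  rewrite -(subnKC Nn); elim: (n - N)%N => [|p IH]; first by rewrite addn0.
  rewrite addnS harmonic_sumS asboolF ?mul0r ?addr0 // => /AN.
  by rewrite ltnNge leq_addr.
have ZT : ~ Zdens R setT.
  move=> /ZdensP/(_ 2^-1); rewrite invr_gt0 ltr0n => /(_ isT)[N /(_ N.+1 (leqnSn N))].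
  have -> : count_below setT N.+1 = N.+1.
    rewrite /count_below -[RHS]card_ord -sum1_card; apply: eq_bigr => k _.
    by rewrite asboolT.
  have : 0 < N.+1%:R :> R by rewrite ltr0n.
  lra.
split; split.
- move=> A B AB /summable_idealP[M BM]; apply/summable_idealP; exists M => n.
  apply: le_trans (BM n); apply: ler_sum => k _.
  by rewrite ler_pM2r ?invr_gt0 // ler_nat asbool_sub.
- move=> A B /summable_idealP[M AM] /summable_idealP[M' BM'].
  apply/summable_idealP; exists (M + M') => n.
  apply: le_trans (lerD (AM n) (BM' n)); rewrite -big_split /=.
  apply: ler_sum => k _; rewrite -mulrDl ler_pM2r ?invr_gt0 //.
  by rewrite -natrD ler_nat asbool_setU.
- exact: finS.
- by move=> /summable_sub_Zdens.
- move=> A B AB /ZdensP BZ; apply/ZdensP => e e0; have [N NP] := BZ e e0.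
  exists N => n /NP; apply: le_trans; rewrite ler_nat.
  by apply: leq_sum => k _; apply: asbool_sub.
- move=> A B /ZdensP AZ /ZdensP BZ; apply/ZdensP => e e0.
  have e2 : 0 < e / 2 by rewrite divr_gt0.
  have [N NP] := AZ _ e2; have [N' NP'] := BZ _ e2.
  exists (maxn N N') => n; rewrite geq_max => /andP[/NP An /NP' Bn].
  have : (count_below (A `|` B) n)%:R <= (count_below A n)%:R + (count_below B n)%:R :> R.
    rewrite -natrD ler_nat -big_split /=.
    by apply: leq_sum => k _; apply: asbool_setU.
  lra.
- by move=> A /finS/summable_sub_Zdens.
- exact: ZT.
Qed.

(** If consecutive elements of [S] more than double, the harmonic sum of [S] is
dominated by a geometric series. *)
Lemma tall_summable (R : realType) : tall (summable_ideal R).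
Proof.
move=> A infA; have [S [SA infS gap]] := sparse_subset (fun k => k.*2) infA.
exists S; split=> //; apply/summable_idealP; exists 2 => n.
(* The induction carries the room left for the remaining terms: those from [j]
   on sum to at most [2 / (j + 1)]. *)
have bound j : S j -> (n <= j)%N -> harmonic_sum R S n <= 2 - 2 / j.+1%:R.
  elim: n j => [|n IH] j Sj nj.
    rewrite /harmonic_sum big_ord0 subr_ge0 ler_pdivrMr // ler_peMr //.
    by rewrite ler1n.
  rewrite harmonic_sumS; case: asboolP => [Sn|_]; last first.
    by rewrite mul0r addr0; apply: IH => //; apply: ltnW.
  have jn : 2 / j.+1%:R <= n.+1%:R^-1 :> R.
    rewrite ler_pdivrMr // mulrC ler_pdivlMr // -natrM ler_nat.
    by have /= := gap _ _ Sn Sj nj; lia.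
  rewrite mul1r; move: (IH n Sn (leqnn n)) jn.
  by move: (n.+1%:R^-1) (2 / j.+1%:R) => p q; lra.
have [j Sj nj] := (infinite_natP S).1 infS n.
apply: le_trans (bound j Sj (ltnW nj)) _.
by rewrite gerBl divr_ge0.
Qed.

Lemma tall_Zdens (R : realType) : tall (Zdens R).
Proof.
move=> A /(@tall_summable R)[B [BA infB /summable_sub_Zdens BZ]].
by exists B.
Qed.

Theorem corollary2p26 (R : realType) :
  (forall J : set (set nat),
     ideal J -> tall J -> translation_invariant J ->
     ~ @scrH R Fin (@Hset R (fun n : nat => (2 ^+ n)%R) J))
  /\ [/\ ideal (Zdens R), tall (Zdens R) & translation_invariant (Zdens R)]
  /\ [/\ ideal (summable_ideal R), tall (summable_ideal R)
       & translation_invariant (summable_ideal R)].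
Proof.
have [idS idZ] := ideal_summable_Zdens R.
split; first by move=> J; apply: not_Hset_Fin.
split; split=> //.
- exact: tall_Zdens.
- exact: translation_invariant_Zdens.
- exact: tall_summable.
- exact: translation_invariant_summable.
Qed.
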